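(* In the edge-distinguishing game (EDGe) played on the path $P_3$ (with $\lambda(P_3)$ colors), Player 1 has a winning strategy.
   Context: $P_n$ is the path on $n$ vertices. For a positive integer $k$ let $[k]=\{1,\dots,k\}$. A $k$-coloring $c:V(G)\to[k]$ induces $c'(\{u,v\})=\{c(u),c(v)\}$ (a multiset); $c$ is edge-distinguishing if $c'$ is injective, and $\lambda(G)$ is the least $k$ admitting such a coloring. A partial coloring on $U\subseteq V(G)$ has partial induced edge coloring on $G[U]$. EDGe on $G$: two players, Player 1 first, alternately color an uncolored vertex with a color from $[\lambda(G)]$; a move is legal iff afterwards the partial induced edge coloring of the colored vertices is injective. The player making the last legal move wins. A winning strategy guarantees a win regardless of the opponent's play. *)

(* Defs.v *)
From HB Require Import structures.
From mathcomp Require Import all_boot.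
From mathcomp Require Import finmap multiset.
Set Implicit Arguments.
Unset Strict Implicit.
Unset Printing Implicit Defensive.
Local Open Scope fset_scope.
Local Open Scope mset_scope.

Record sgraph := SGraph {
  vertex :> finType;
  adj : rel vertex;
  adj_sym : symmetric adj;
  adj_irrefl : irreflexive adj
}.

Definition edges (G : sgraph) : {set {set G}} :=
  [set e | [exists u, exists v, @adj G u v && (e == [set u; v])]].

Definition path_adj (n : nat) : rel 'I_n :=
  fun i j => (i.+1 == j :> nat) || (j.+1 == i :> nat).

Lemma path_adj_sym (n : nat) : symmetric (@path_adj n).
Proof. by move=> i j; rewrite /path_adj orbC. Qed.

Lemma path_adj_irrefl (n : nat) : irreflexive (@path_adj n).
Proof. by move=> i; rewrite /path_adj orbb; apply: gtn_eqF. Qed.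

Definition path_graph (n : nat) : sgraph :=
  SGraph (@path_adj_sym n) (@path_adj_irrefl n).

(* The color set [k] = {1, ..., k} is represented by 'I_k = {0, ..., k-1}.    *)
(* An edge is a two-element vertex set, so its induced color is the multiset  *)
(* of the colors of its two ends, with multiplicity 2 if they agree.          *)
Definition induced_color (G : sgraph) (k : nat) (c : G -> 'I_k)
    (e : {set G}) : {mset 'I_k} :=
  seq_mset [seq c v | v <- enum e].

Definition edge_distinguishing (G : sgraph) (k : nat) (c : G -> 'I_k) : bool :=
  dinjectiveb (induced_color c) (edges G).

Definition edge_distinguishable (G : sgraph) (k : nat) : bool :=
  (0 < k) && [exists c : {ffun G -> 'I_k}, edge_distinguishing c].

Lemma edge_distinguishable_ex (G : sgraph) :
  exists k, edge_distinguishable G k.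
Proof.
exists #|G|.+1; rewrite /edge_distinguishable /=; apply/existsP.
pose f (v : G) := widen_ord (leqnSn #|G|) (enum_rank v).
have f_inj : injective f.
  by move=> u v /(congr1 (@nat_of_ord _)) /= /ord_inj /enum_rank_inj.
exists [ffun v => f v]; apply/dinjectiveP => e1 e2 _ _ /eq_seq_msetP pe.
apply/setP => v; have := perm_mem pe (f v).
by rewrite !(eq_map (ffunE f)) !(mem_map f_inj) !mem_enum.
Qed.

Definition lambda (G : sgraph) : nat := ex_minn (edge_distinguishable_ex G).

Definition pcoloring (G : sgraph) (k : nat) := {ffun G -> option 'I_k}.

Definition colored (G : sgraph) (k : nat) (c : pcoloring G k) : {set G} :=
  [set v | c v != None].

Definition pinduced_color (G : sgraph) (k : nat) (c : pcoloring G k)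
    (e : {set G}) : {mset 'I_k} :=
  seq_mset (pmap c (enum e)).

(* The edges of the induced subgraph G[U] are the edges of G included in U.   *)
Definition pedge_distinguishing (G : sgraph) (k : nat)
    (c : pcoloring G k) : bool :=
  dinjectiveb (pinduced_color c) [set e in edges G | e \subset colored c].

Definition move (G : sgraph) (k : nat) : Type := (G * 'I_k)%type.

Definition uncolored (G : sgraph) (k : nat) : pcoloring G k := [ffun=> None].

Definition play_move (G : sgraph) (k : nat) (c : pcoloring G k)
    (m : move G k) : pcoloring G k :=
  [ffun v => if v == m.1 then Some m.2 else c v].

Definition legal_move (G : sgraph) (k : nat) (c : pcoloring G k)
    (m : move G k) : bool :=
  (c m.1 == None) && pedge_distinguishing (play_move c m).

Fixpoint legal_from (G : sgraph) (k : nat) (c : pcoloring G k)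
    (h : seq (move G k)) : bool :=
  if h is m :: h' then legal_move c m && legal_from (play_move c m) h'
  else true.

Definition legal_play (G : sgraph) (k : nat) (h : seq (move G k)) : bool :=
  legal_from (uncolored G k) h.

Definition complete_play (G : sgraph) (k : nat) (h : seq (move G k)) : Prop :=
  legal_play h /\ forall m, ~~ legal_play (rcons h m).

Inductive player := Player1 | Player2.

Definition to_move (G : sgraph) (k : nat) (h : seq (move G k)) : player :=
  if odd (size h) then Player2 else Player1.

Definition wins (G : sgraph) (k : nat) (p : player)
    (h : seq (move G k)) : Prop :=
  complete_play h /\ exists h' m, h = rcons h' m /\ to_move h' = p.

(* [strategy_for] rules out None when the owner is to move and can do so. *)
Definition strategy (G : sgraph) (k : nat) : Type :=
  seq (move G k) -> option (move G k).

Definition strategy_for (G : sgraph) (k : nat) (p : player)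
    (s : strategy G k) : Prop :=
  forall h, legal_play h -> to_move h = p ->
    (exists m, legal_play (rcons h m)) ->
    exists m, s h = Some m /\ legal_play (rcons h m).

Definition follows (G : sgraph) (k : nat) (p : player) (s : strategy G k)
    (h : seq (move G k)) : Prop :=
  forall h1 m h2, h = rcons h1 m ++ h2 -> to_move h1 = p -> s h1 = Some m.

Definition winning_strategy (G : sgraph) (k : nat) (p : player)
    (s : strategy G k) : Prop :=
  strategy_for p s /\
  forall h, complete_play h -> follows p s h -> wins p h.

(* Main.v *)
(** Two edges [uv], [vw] of [P_3] receive the same color exactly when the two
    ends [u] and [w] do, so [lambda P_3 >= 2] and a move is illegal only if it
    completes a coloring whose ends agree.  Player 1 colors the middle vertex;
    whatever end Player 2 then colors, the other end can be given a different
    color.  Hence every play consistent with this opening lasts exactly three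
    moves. *)

From mathcomp Require Import all_boot.
From mathcomp Require Import finmap multiset.
Require Import Defs.
Set Implicit Arguments.
Unset Strict Implicit.
Unset Printing Implicit Defensive.

Lemma colored_play_move (G : sgraph) (k : nat) (c : pcoloring G k)
    (m : move G k) :
  colored (play_move c m) = m.1 |: colored c.
Proof. by apply/setP => v; rewrite !inE ffunE; case: (v =P m.1). Qed.

(** Each legal move colors a fresh vertex, so the colored set grows by exactly one per move. *)
Lemma legal_from_size (G : sgraph) (k : nat) (h : seq (move G k))
    (c : pcoloring G k) :
  legal_from c h -> #|colored c| + size h <= #|G|.
Proof.
elim: h c => [|m h IHh] c /=; first by rewrite addn0 max_card.
case/andP=> /andP[uncol _] /IHh.
by rewrite colored_play_move cardsU1 inE uncol add1n addSnnS.
Qed.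

Lemma legal_play_size (G : sgraph) (k : nat) (h : seq (move G k)) :
  legal_play h -> size h <= #|G|.
Proof.
by move/legal_from_size; apply: leq_trans; apply: leq_addl.
Qed.

(** Lets the criterion for partial colorings of the path also serve to bound [lambda]. *)
Lemma edge_distinguishingE (G : sgraph) (k : nat) (c : G -> 'I_k) :
  edge_distinguishing c =
  pedge_distinguishing ([ffun v => Some (c v)] : pcoloring G k).
Proof.
set pc : pcoloring G k := finfun _.
have colE e : pinduced_color pc e = induced_color c e.
  rewrite /pinduced_color /induced_color; congr seq_mset.
  by elim: (enum e) => //= v s ->; rewrite ffunE.
have domE : [set e in edges G | e \subset colored pc] =i edges G.
  move=> e; rewrite inE; case: (e \in edges G) => //=.
  by apply/subsetP => v _; rewrite inE ffunE.
apply/dinjectiveP/dinjectiveP => inj_c e f.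
  by rewrite !domE !colE; apply: inj_c.
by move=> He Hf; rewrite -!colE; apply: inj_c; rewrite domE.
Qed.

(** [enum] follows the order of [T], not that of the notation; a permutation is enough for
    multisets. *)
Lemma perm_enum_set2 (T : finType) (u v : T) :
  u != v -> perm_eq (enum [set u; v]) [:: u; v].
Proof.
move=> neq_uv; apply: uniq_perm; rewrite ?enum_uniq //= ?inE ?neq_uv //.
by move=> w; rewrite mem_enum !inE.
Qed.

Lemma pinduced_color_set2 (G : sgraph) (k : nat) (c : pcoloring G k)
    (u v : G) (a b : 'I_k) :
  u != v -> c u = Some a -> c v = Some b ->
  pinduced_color c [set u; v] = seq_mset [:: a; b].
Proof.
move=> neq_uv cu cv; apply/eq_seq_msetP.
have -> : [:: a; b] = pmap c [:: u; v] by rewrite /= cu cv.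
exact: perm_pmap (perm_enum_set2 neq_uv).
Qed.

Lemma ord_neq_exists (k : nat) (b : 'I_k) : 1 < k -> exists d : 'I_k, d != b.
Proof.
move=> lt1k; have lt0k := ltnW lt1k.
have [b0|bN0] := eqVneq (b : nat) 0.
  by exists (Ordinal lt1k); rewrite -val_eqE /= b0.
by exists (Ordinal lt0k); rewrite -val_eqE /= eq_sym.
Qed.

Section PathThree.

Local Notation P3 := (path_graph 3).
Local Notation left_end := (@inord 2 0 : P3).
Local Notation middle := (@inord 2 1 : P3).
Local Notation right_end := (@inord 2 2 : P3).

Lemma inord3_eq (i j : nat) :
  i < 3 -> j < 3 -> (@inord 2 i == @inord 2 j) = (i == j).
Proof. by move=> lti ltj; rewrite -val_eqE /= !inordK. Qed.

Lemma path3_cases (v : P3) : [\/ v = left_end, v = middle | v = right_end].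
Proof.
case: v => [[|[|[|//]]] ltv];
  [constructor 1|constructor 2|constructor 3];
  by apply/val_inj; rewrite /= inordK.
Qed.

Lemma edges_path3 :
  edges P3 = [set [set left_end; middle]; [set middle; right_end]].
Proof.
apply/setP => e; rewrite !inE; apply/existsP/orP.
  case=> u /existsP[v /andP[]].
  case: (path3_cases u) => ->; case: (path3_cases v) => ->;
    rewrite /= /path_adj !inordK //= => _ /eqP->; rewrite ?eqxx;
    by [left | right | rewrite setUC eqxx; left | rewrite setUC eqxx; right].
case=> /eqP->.
  by exists left_end; apply/existsP; exists middle; rewrite eqxx /= /path_adj !inordK.
by exists middle; apply/existsP; exists right_end; rewrite eqxx /= /path_adj !inordK.
Qed.

Lemma path3_edges_neq : [set left_end; middle] != [set middle; right_end].
Proof.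
by apply/eqP => /setP/(_ left_end); rewrite !inE !inord3_eq.
Qed.

(** Injectivity can fail only when both edges are colored, and then they share the middle color. An
    uncolored right end falls under the last disjunct, where [None] differs from the color of the
    left end. *)
Lemma pedge_distinguishing_path3 (k : nat) (c : pcoloring P3 k) :
  pedge_distinguishing c =
  [|| c left_end == None, c middle == None | c left_end != c right_end].
Proof.
have domE e : (e \in [set e in edges P3 | e \subset colored c]) =
    [|| [&& e == [set left_end; middle], c left_end != None & c middle != None]
      | [&& e == [set middle; right_end], c middle != None & c right_end != None]].
  rewrite inE edges_path3 !inE.
  have [->|_] /= := eqVneq e [set left_end; middle].
    by rewrite (negPf path3_edges_neq) orbF subUset !sub1set !inE.
  by have [->|_] //= := eqVneq e; rewrite subUset !sub1set !inE.
apply/dinjectiveP/idP => [inj_c|].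
  case cl: (c left_end) => [a|] //=; case cm: (c middle) => [b|] //=.
  (* Ends of equal color would give both edges the same multiset, and injectivity would identify the
     edges. *)
  apply: contra path3_edges_neq; rewrite eq_sym => /eqP cr; apply/eqP/inj_c.
  - by rewrite domE eqxx cl cm.
  - by rewrite domE eqxx cr cm orbT.
  rewrite (pinduced_color_set2 _ cl cm) ?(pinduced_color_set2 _ cm cr);
    rewrite ?inord3_eq //.
  by apply/eq_seq_msetP; rewrite (perm_catC [:: a] [:: b]).
(* Unless all three vertices are colored, at most one edge lies in the domain and injectivity is
   trivial. *)
case cl: (c left_end) domE => [a|] domE;
  case cm: (c middle) domE => [b|] domE;
  case cr: (c right_end) domE => [d|] domE => /= neq_ad e f;
  rewrite !domE ?andbF ?andbT ?orbF //; try by do 2!move/eqP->.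
have colN : pinduced_color c [set left_end; middle] !=
            pinduced_color c [set middle; right_end].
  rewrite (pinduced_color_set2 _ cl cm) ?(pinduced_color_set2 _ cm cr);
    rewrite ?inord3_eq //.
  apply: contra neq_ad => /eqP/eq_seq_msetP.
  (* Moving [b] to the end of both lists allows it to be cancelled, leaving [a = d]. *)
  rewrite perm_sym (perm_catC [:: b] [:: d]) perm_sym.
  rewrite (perm_cat2r [:: b] [:: a] [:: d]) => /perm_mem/(_ a).
  by rewrite !inE eqxx => /esym/eqP->.
by case/orP=> /eqP-> /orP[] /eqP-> // /eqP; rewrite ?(negPf colN) // eq_sym (negPf colN).
Qed.

Lemma lambda_path3 : 1 < lambda P3.
Proof.
(* Zero colors are excluded by positivity; a single color makes the two ends agree. *)
rewrite /lambda; case: ex_minnP => [[|[|//]]] /andP[// _ /existsP[c ED_c]] _.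
move: ED_c; rewrite edge_distinguishingE pedge_distinguishing_path3 !ffunE /=.
by rewrite (ord1 (c left_end)) (ord1 (c right_end)) eqxx.
Qed.

(** Shows that the play cannot stop after the opening. Reusing [a] is harmless, as only one edge is
    colored. *)
Lemma path3_second_move (k : nat) (a : 'I_k) :
  legal_play [:: (middle, a); (left_end, a)].
Proof.
rewrite /legal_play /= /legal_move /= !pedge_distinguishing_path3.
by rewrite !ffunE /= !inord3_eq.
Qed.

Lemma path3_third_move (k : nat) (a : 'I_k) (m : move P3 k) :
  1 < k -> legal_play [:: (middle, a); m] ->
  exists m', legal_play [:: (middle, a); m; m'].
Proof.
case: m => v b lt1k; have [d neq_db] := ord_neq_exists b lt1k.
rewrite /legal_play /= /legal_move /= !pedge_distinguishing_path3 !ffunE /=.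
have neq_bd : Some b != Some d by rewrite eq_sym.
(* The reply at the middle is not legal, so only the two ends remain; the opposite end receives
   [d]. *)
case: (path3_cases v) => ->; rewrite ?inord3_eq //= ?ffunE /= ?inord3_eq //= => _.
- exists (right_end, d).
  by rewrite pedge_distinguishing_path3 !ffunE /= !inord3_eq //= neq_bd.
exists (left_end, d).
by rewrite pedge_distinguishing_path3 !ffunE /= !inord3_eq //= eq_sym neq_bd.
Qed.

(** After the opening any legal move will do, since the length of the play is already forced. *)
Definition middle_first (k : nat) (a : 'I_k) : strategy P3 k :=
  fun h => if h is [::] then Some (middle, a)
           else [pick m : P3 * 'I_k | legal_play (rcons h m)].

Lemma middle_first_winning (k : nat) (a : 'I_k) :
  1 < k -> winning_strategy Player1 (middle_first a).
Proof.
move=> lt1k; have opening : legal_play [:: ((middle, a) : move P3 k)].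
  by have := path3_second_move a; rewrite /legal_play /= => /andP[->].
split=> [[|m0 h] legal_h _ [m legal_m]|h complete_h follows_h].
- by exists (middle, a).
- rewrite /middle_first; case: pickP => [m' legal_m'|no_move].
    by exists m'.
  by rewrite no_move in legal_m.
(* The last of three moves follows a history of even length 2, hence belongs to Player 1. *)
suff size_h : size h = 3.
  split=> //; case/lastP: h size_h {complete_h follows_h} => // h m.
  by rewrite size_rcons => -[size_h]; exists h, m; rewrite /to_move size_h.
case: complete_h => legal_h stuck; have := legal_play_size legal_h.
rewrite card_ord.
case: h follows_h legal_h stuck => [|m1 h] follows_h legal_h stuck.
  by have := stuck (middle, a); rewrite opening.
(* Following the strategy fixes the first move. *)
have [m1E] : Some (middle, a) = Some m1 by exact: (follows_h [::] m1 h).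
subst m1; clear follows_h.
(* More than three moves exceed the number of vertices; one or two moves can still be extended,
   against completeness. *)
case: h legal_h stuck => [|m2 [|m3 [|//]]] legal_h stuck //.
  by have := stuck (left_end, a); rewrite path3_second_move.
have [m3 legal_m3] := path3_third_move lt1k legal_h.
by have := stuck m3; rewrite legal_m3.
Qed.

End PathThree.

Theorem theorem3p8 :
  exists s : strategy (path_graph 3) (lambda (path_graph 3)),
    winning_strategy Player1 s.
Proof.
exists (middle_first (Ordinal (ltnW lambda_path3))).
exact: middle_first_winning lambda_path3.
Qed.
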